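(* Let $m \ge 2$ and let $G_{m,2}=S_m \Box P_2$ be the stacked-book graph. Then $im(G_{m,2})=m-1$.
   Context: $S_m$ is the star graph with one central vertex and $m-1$ leaves ($m$ vertices in total); $P_n$ is the path on $n$ vertices. The stacked-book graph $G_{m,n}=S_m\Box P_n$ is the Cartesian product: it consists of $n$ copies $S_m(1),\dots,S_m(n)$ of $S_m$, and for each $i\in[1,n-1]$ each vertex of $S_m(i)$ is joined to the corresponding vertex of $S_m(i+1)$. An induced matching of a graph $G$ is a set $M$ of edges such that no two edges of $M$ share an endpoint and no edge of $G$ joins an endpoint of one edge of $M$ to an endpoint of another edge of $M$; $im(G)$ is the maximum size of an induced matching of $G$. *)

(* Defs.v *)
(* MathComp. A finite simple graph is a symmetric irreflexive relation on a
   finType. *)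
From mathcomp Require Import all_boot.

Set Implicit Arguments.
Unset Strict Implicit.
Unset Printing Implicit Defensive.

(* The vertex 0 is the centre; the other m - 1 vertices are the leaves. *)
Definition star (m : nat) : rel 'I_m :=
  fun i j => (i != j) && ((val i == 0) || (val j == 0)).
Arguments star : clear implicits.

Definition path_graph (n : nat) : rel 'I_n :=
  fun i j => (i.+1 == j) || (j.+1 == i).
Arguments path_graph : clear implicits.

Definition cartesian_product (T U : finType) (e : rel T) (f : rel U) :
    rel (T * U) :=
  fun x y => ((x.1 == y.1) && f x.2 y.2) || ((x.2 == y.2) && e x.1 y.1).

Definition stacked_book (m n : nat) : rel ('I_m * 'I_n) :=
  cartesian_product (star m) (path_graph n).
Arguments stacked_book : clear implicits.

Definition edges (T : finType) (e : rel T) : {set {set T}} :=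
  [set [set p.1; p.2] | p : T * T & e p.1 p.2].

Definition induced_matching (T : finType) (e : rel T) (M : {set {set T}}) :
    bool :=
  (M \subset edges e) &&
  [forall A in M, forall B in M, (A != B) ==>
     [disjoint A & B] && [forall x in A, forall y in B, ~~ e x y]].

Definition im (T : finType) (e : rel T) : nat :=
  \max_(M : {set {set T}} | induced_matching e M) #|M|.

Lemma star_sym m : symmetric (star m).
Proof. by move=> i j; rewrite /star eq_sym orbC. Qed.

Lemma star_irr m : irreflexive (star m).
Proof. by move=> i; rewrite /star eqxx. Qed.

Lemma path_graph_sym n : symmetric (path_graph n).
Proof. by move=> i j; rewrite /path_graph orbC. Qed.

Lemma path_graph_irr n : irreflexive (path_graph n).
Proof. by move=> i; rewrite /path_graph orbb gtn_eqF. Qed.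

Lemma cartesian_product_sym (T U : finType) (e : rel T) (f : rel U) :
  symmetric e -> symmetric f -> symmetric (cartesian_product e f).
Proof.
move=> se sf x y.
by rewrite /cartesian_product (eq_sym x.1) (eq_sym x.2) se sf.
Qed.

Lemma cartesian_product_irr (T U : finType) (e : rel T) (f : rel U) :
  irreflexive e -> irreflexive f -> irreflexive (cartesian_product e f).
Proof. by move=> ie jf x; rewrite /cartesian_product ie jf !andbF. Qed.

Lemma stacked_book_sym m n : symmetric (stacked_book m n).
Proof. exact: cartesian_product_sym (@star_sym m) (@path_graph_sym n). Qed.

Lemma stacked_book_irr m n : irreflexive (stacked_book m n).
Proof. exact: cartesian_product_irr (@star_irr m) (@path_graph_irr n). Qed.

(* Main.v *)
Require Import Defs.
From mathcomp Require Import all_boot.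

(** A centre of [S_m □ P_2] has a closed neighbourhood that meets every edge,
    so an induced matching covering a centre is a single edge. An induced
    matching avoiding both centres consists of rungs [{(i, 0), (i, 1)}] over
    leaves [i], and the set of all [m - 1] such rungs is an induced matching. *)

Definition rung {m : nat} (i : 'I_m) : {set 'I_m * 'I_2} :=
  [set (i, ord0); (i, ord_max)].

Definition leaf_rungs (m : nat) : {set {set 'I_m * 'I_2}} :=
  [set rung i | i in [set i : 'I_m | val i != 0]].

Lemma ord2_cases (k : 'I_2) : k = ord0 \/ k = ord_max.
Proof. by case: k => [[|[|k]] hk] //; [left | right]; apply: val_inj. Qed.

Lemma rung_inj (m : nat) : injective (@rung m).
Proof.
move=> i j /setP /(_ (i, ord0)).
by rewrite !inE !xpair_eqE !eqxx /= andbT andbF orbF => /esym/eqP.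
Qed.

Lemma card_leaf_rungs (m : nat) : #|leaf_rungs m.+1| = m.
Proof.
rewrite (card_imset _ (@rung_inj _)).
have -> : [set i : 'I_m.+1 | val i != 0] = [set~ ord0].
  by apply/setP => i; rewrite !inE.
by rewrite cardsC1 card_ord.
Qed.

(** As ['I_2] has only two elements, a rung is a whole fibre of the first projection. *)
Lemma mem_rung (m : nat) (i : 'I_m) (x : 'I_m * 'I_2) :
  (x \in rung i) = (x.1 == i).
Proof.
case: x => j k; rewrite !inE !xpair_eqE -andb_orr /=.
by case: (ord2_cases k) => ->; rewrite andbT.
Qed.

(** Over distinct leaves nothing is adjacent: a path edge keeps the first coordinate, and a star
    edge needs a centre. *)
Lemma leaf_rungs_induced (m : nat) :
  induced_matching (stacked_book m 2) (leaf_rungs m).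
Proof.
apply/andP; split.
  apply/subsetP => _ /imsetP[i _ ->]; apply/imsetP.
  by exists ((i, ord0), (i, ord_max)); rewrite // inE /stacked_book
    /cartesian_product /= eqxx.
apply/forall_inP => _ /imsetP[i i_leaf ->].
apply/forall_inP => _ /imsetP[j j_leaf ->].
rewrite !inE in i_leaf j_leaf.
apply/implyP => ne_ij; have {}ne_ij : i != j by apply: contraNneq ne_ij => ->.
apply/andP; split.
  apply/pred0P => x /=; rewrite !mem_rung.
  by case: eqP => //= ->; apply: negbTE.
apply/forall_inP => x; rewrite mem_rung => /eqP xi.
apply/forall_inP => y; rewrite mem_rung => /eqP yj.
by rewrite /stacked_book /cartesian_product /star xi yj (negbTE ne_ij)
  (negbTE i_leaf) (negbTE j_leaf) /= !andbF.
Qed.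

(** An edge coming from [path_graph] is a rung; one coming from [star] has a centre among its
    endpoints. *)
Lemma edge_cases (m : nat) (A : {set 'I_m * 'I_2}) :
  A \in edges (stacked_book m 2) ->
  (exists i, A = rung i) \/ (exists2 x, x \in A & val x.1 = 0).
Proof.
case/imsetP=> [[[i k] [j l]]]; rewrite inE /= => /orP[] /= /andP[] /eqP /=.
  move=> <- kl ->; left; exists i.
  case: (ord2_cases k) kl => ->; case: (ord2_cases l) => -> // _.
  exact: setUC.
move=> <- /andP[_ /orP[]] /eqP c0 ->; right.
  by exists (i, k); rewrite // set21.
by exists (j, k); rewrite // set22.
Qed.

(** A rung meets the layer of [c], where every vertex is [c] or a neighbour of [c]. Any other edge
    contains a centre, and the two centres are adjacent. *)
Lemma center_dominates_edge (m : nat) (c : 'I_m * 'I_2)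
    (A : {set 'I_m * 'I_2}) :
  val c.1 = 0 -> A \in edges (stacked_book m 2) ->
  exists2 x, x \in A & (x == c) || stacked_book m 2 c x.
Proof.
case: c => c k /= c0 /edge_cases[[i ->] | [[i l] xA /= i0]].
  exists (i, k); first by rewrite mem_rung.
  rewrite xpair_eqE eqxx andbT /stacked_book /cartesian_product /star /=.
  by rewrite c0 !eqxx andbT eq_sym; case: eqP; rewrite ?orbT.
have ic : i = c by apply: val_inj; rewrite /= i0.
exists (i, l) => //; rewrite ic xpair_eqE eqxx /=.
rewrite /stacked_book /cartesian_product /path_graph /= eqxx.
by case: (ord2_cases k) => ->; case: (ord2_cases l) => ->.
Qed.

Lemma induced_matching_le (m : nat) (M : {set {set 'I_m.+2 * 'I_2}}) :
  induced_matching (stacked_book m.+2 2) M -> #|M| <= m.+1.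
Proof.
case/andP=> /subsetP Medges /forall_inP Msep.
case: (boolP [exists A in M, [exists x in A, val x.1 == 0]]).
  case/exists_inP=> A AM /exists_inP[c cA /eqP c0].
  suff /subset_leq_card : M \subset [set A].
    (* A single edge respects the bound because [1 <= m.+1]. *)
    by rewrite cards1 => /leq_trans ->.
  apply/subsetP => B BM; rewrite inE eq_sym; apply: contraT => neAB.
  have /implyP/(_ neAB)/andP[dAB /forall_inP nAB] := forall_inP (Msep A AM) B BM.
  (* Were [B] distinct from [A], its vertex [x] would violate disjointness if [x = c], and
     inducedness if [x] is adjacent to [c]. *)
  have [x xB /orP[/eqP xc|cx]] := center_dominates_edge _ _ _ c0 (Medges B BM).
    by move/pred0P: dAB => /(_ c) /=; rewrite cA -xc xB.
  by have /forall_inP/(_ x xB) := nAB c cA; rewrite cx.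
(* Reading [m.+1] as the number of leaf rungs reduces the bound to an inclusion of [M] in
   [leaf_rungs]. *)
move=> noC; rewrite -[X in _ <= X]card_leaf_rungs.
apply/subset_leq_card/subsetP => A AM.
have {}noC x : x \in A -> val x.1 != 0.
  move=> xA; apply: contra noC => x0.
  by apply/exists_inP; exists A => //; apply/exists_inP; exists x.
case: (edge_cases _ _ (Medges A AM)) => [[i Ai] | [x /noC/eqP]] //.
rewrite Ai; apply: imset_f; rewrite inE.
by apply: (noC (i, ord0)); rewrite Ai mem_rung.
Qed.

Theorem theorem5 (m : nat) (hm : 2 <= m) : im (stacked_book m 2) = m - 1.
Proof.
case: m hm => [|[|m]] // _; rewrite subn1 /=.
apply/eqP; rewrite eqn_leq; apply/andP; split.
  by apply/bigmax_leqP => M; apply: induced_matching_le.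
rewrite -[X in X <= _]card_leaf_rungs.
exact: (leq_bigmax_cond _ (leaf_rungs_induced _)).
Qed.
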